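(* Let $R$ be a ring. Then $R$ is an abelian ring in which every zero-divisor is a very idempotent or a nilpotent element if and only if $R$ is isomorphic to one of the following: (a) a D-ring; (b) a Boolean ring; (c) $\mathbb{Z}_3\oplus\mathbb{Z}_3$; (d) $\mathbb{Z}_3\oplus B$ where $B$ is a Boolean ring.
   Context: All rings are associative with identity, not necessarily commutative. $\mathbb{Z}_3=\mathbb{Z}/3\mathbb{Z}$. An element $a\in R$ is a zero-divisor if there exist nonzero $b,c\in R$ with $ab=0=ca$. An element $e\in R$ is a very idempotent if $e$ or $-e$ is an idempotent. $R$ is abelian if every idempotent of $R$ is central. $R$ is a D-ring if every zero-divisor in $R$ is nilpotent. A ring is Boolean if every element is an idempotent. *)

(* Defs.v *)
From HB Require Import structures.
From mathcomp Require Import all_boot all_order all_algebra.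

Set Implicit Arguments.
Unset Strict Implicit.
Unset Printing Implicit Defensive.

Import GRing.Theory.
Local Open Scope ring_scope.

(* Rings are [pzRingType]: unital, associative, possibly noncommutative, and
   the zero ring (1 = 0) is allowed. *)

Section Elements.
Variable R : pzRingType.

Definition zero_divisor (a : R) : Prop :=
  exists b c : R, [/\ b <> 0, c <> 0, a * b = 0 & c * a = 0].

Definition idempotent (e : R) : Prop := e * e = e.

Definition very_idempotent (e : R) : Prop := idempotent e \/ idempotent (- e).

Definition nilpotent (a : R) : Prop := exists n : nat, (0 < n)%N /\ a ^+ n = 0.

End Elements.

Definition abelian_ring (R : pzRingType) : Prop :=
  forall e : R, idempotent e -> forall x : R, GRing.comm e x.

Definition D_ring (R : pzRingType) : Prop :=
  forall a : R, zero_divisor a -> nilpotent a.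

Definition Boolean_ring (R : pzRingType) : Prop := forall x : R, idempotent x.

Definition ring_isomorphic (R S : pzRingType) : Prop :=
  exists f : {rmorphism R -> S}, bijective f.

(* Main.v *)
(** If [R] has only trivial idempotents, its very idempotent zero-divisors are
    zero and [R] is a D-ring. Otherwise a nontrivial central idempotent [e]
    makes every element of [eR] and [(1 - e)R] a zero-divisor; this forces [R]
    to be reduced and to satisfy [x^3 = x], hence [6 = 0]. The idempotent
    [h = 4] splits [R] into the Boolean corner [(1 - h)R = 3R] and the corner
    [hR] of characteristic 3. An element [u] of [hR] is the difference of the
    idempotents [-(u + u^2)] and [u - u^2], so if [h] is primitive, then
    [hR = {0, h, -h}] is [Z_3] (or [h = 0] and [R] is Boolean). If
    [h = r + q] splits, then [r - q] cannot be a zero-divisor, so [r + q = 1],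
    both parts are primitive and [R] is [Z_3 * Z_3]. *)
Require Import Defs.
From HB Require Import structures.
From mathcomp Require Import all_boot all_order all_algebra.
From Stdlib Require Import Classical.
Local Open Scope ring_scope.

Set Implicit Arguments.
Unset Strict Implicit.
Unset Printing Implicit Defensive.
Import GRing.Theory.

(** * Ring isomorphisms and their products *)

Lemma ring_isomorphic_refl (R : pzRingType) : ring_isomorphic R R.
Proof. by exists idfun; exists idfun. Qed.

(** The morphism may be given in the direction opposite to the isomorphism. This serves ['Z_3],
    whose natural map goes out of it. *)
Lemma can2_ring_isomorphic (R S : pzRingType) (g : {rmorphism S -> R})
    (f : R -> S) : cancel f g -> cancel g f -> ring_isomorphic R S.
Proof.
move=> fK gK.
have fB : zmod_morphism f by apply: can2_zmod_morphism gK fK.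
have fM : monoid_morphism f by apply: can2_monoid_morphism gK fK.
pose fBb := GRing.isZmodMorphism.Build R S f fB.
pose fMb := GRing.isMonoidMorphism.Build R S f fM.
pose F : {rmorphism R -> S} := HB.pack f fBb fMb.
by exists F; exists g.
Qed.

Lemma ring_isomorphic_trans (R S T : pzRingType) :
  ring_isomorphic R S -> ring_isomorphic S T -> ring_isomorphic R T.
Proof.
move=> [f bf] [g bg]; exists (g \o f : {rmorphism R -> T}).
exact: bij_comp.
Qed.

Section ProductIsomorphism.
Variables (R1 R2 S1 S2 : pzRingType).
Variables (f1 : {rmorphism R1 -> S1}) (f2 : {rmorphism R2 -> S2}).

Definition prod_map (x : R1 * R2) : S1 * S2 := (f1 x.1, f2 x.2).

Fact prod_map_zmod_morphism : zmod_morphism prod_map.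
Proof. by move=> x y; rewrite /prod_map /= !rmorphB. Qed.

Fact prod_map_monoid_morphism : monoid_morphism prod_map.
Proof.
by split=> [|x y]; rewrite /prod_map /= ?rmorph1 ?rmorphM.
Qed.

HB.instance Definition _ :=
  GRing.isZmodMorphism.Build (R1 * R2)%type (S1 * S2)%type prod_map
    prod_map_zmod_morphism.
HB.instance Definition _ :=
  GRing.isMonoidMorphism.Build (R1 * R2)%type (S1 * S2)%type prod_map
    prod_map_monoid_morphism.

End ProductIsomorphism.

Lemma ring_isomorphic_prod (R1 R2 S1 S2 : pzRingType) :
  ring_isomorphic R1 S1 -> ring_isomorphic R2 S2 ->
  ring_isomorphic (R1 * R2)%type (S1 * S2)%type.
Proof.
move=> [f1 [g1 f1K g1K]] [f2 [g2 f2K g2K]].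
exists (prod_map f1 f2 : {rmorphism _ -> _}).
exists (fun y => (g1 y.1, g2 y.2)) => -[x y] /=.
  by rewrite /prod_map /= f1K f2K.
by rewrite /prod_map /= g1K g2K.
Qed.

(** * Corner rings and the Peirce decomposition *)

Record central_idempotent (R : pzRingType) := CentralIdempotent {
  cidem_val : R;
  cidem_idem : cidem_val * cidem_val = cidem_val;
  cidem_comm : forall x : R, GRing.comm cidem_val x }.

Section Corner.
Variables (R : pzRingType) (e : central_idempotent R).
Local Notation ev := (cidem_val e).

Definition corner_pred : {pred R} := [pred x | ev * x == x].

(** This is the ideal eR. Its identity is e, so in general it is not a subring of R, and only the
    additive structure is inherited. *)
Definition corner := {x : R | x \in corner_pred}.

Fact corner_zmod_closed : zmod_closed corner_pred.
Proof.
split=> [|x y]; rewrite !inE ?mulr0 // => /eqP ex /eqP ey.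
by rewrite mulrBr ex ey.
Qed.

HB.instance Definition _ := GRing.isZmodClosed.Build R corner_pred
  corner_zmod_closed.
HB.instance Definition _ := [isSub of corner for @sval R _].
HB.instance Definition _ := [Choice of corner by <:].
HB.instance Definition _ := [SubChoice_isSubZmodule of corner by <:].

Fact corner_mul_subproof (x y : corner) : val x * val y \in corner_pred.
Proof. by case: x => x /= /eqP ex; rewrite inE mulrA ex. Qed.

Fact corner_proj_subproof (x : R) : ev * x \in corner_pred.
Proof. by rewrite inE mulrA (cidem_idem e). Qed.

Fact corner_one_subproof : ev \in corner_pred.
Proof. by rewrite inE (cidem_idem e). Qed.

Definition corner_of (x : R) (ex : x \in corner_pred) : corner :=
  exist (fun z => z \in corner_pred) x ex.
Definition corner_mul (x y : corner) : corner :=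
  corner_of (corner_mul_subproof x y).
Definition corner_one : corner := corner_of corner_one_subproof.
Definition corner_proj (x : R) : corner := corner_of (corner_proj_subproof x).

Lemma corner_mul1 (x : corner) : ev * val x = val x.
Proof. by case: x => x /= /eqP. Qed.

Fact corner_mulA : associative corner_mul.
Proof. by move=> x y z; apply: val_inj; rewrite /= mulrA. Qed.
Fact corner_mul1l : left_id corner_one corner_mul.
Proof. by move=> x; apply: val_inj; rewrite /= corner_mul1. Qed.
Fact corner_mul1r : right_id corner_one corner_mul.
Proof.
by move=> x; apply: val_inj; rewrite /= -(cidem_comm e) corner_mul1.
Qed.
Fact corner_mulDl : left_distributive corner_mul +%R.
Proof. by move=> x y z; apply: val_inj; apply: mulrDl. Qed.
Fact corner_mulDr : right_distributive corner_mul +%R.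
Proof. by move=> x y z; apply: val_inj; apply: mulrDr. Qed.

HB.instance Definition _ := GRing.Zmodule_isPzRing.Build corner
  corner_mulA corner_mul1l corner_mul1r corner_mulDl corner_mulDr.

End Corner.

(** Kept transparent by [Defined], so that [cidem_val] of the complement reduces to
    [1 - cidem_val e]. *)
Definition cidem_compl (R : pzRingType) (e : central_idempotent R) :
  central_idempotent R.
Proof.
exists (1 - cidem_val e).
  by rewrite mulrBr mulr1 mulrBl mul1r (cidem_idem e) subrr subr0.
by move=> x; rewrite /GRing.comm mulrBl mulrBr mul1r mulr1 (cidem_comm e).
Defined.

Section Peirce.
Variables (R : pzRingType) (e : central_idempotent R).

Definition peirce (x : R) : corner e * corner (cidem_compl e) :=
  (corner_proj e x, corner_proj (cidem_compl e) x).

Lemma corner_proj_zmod_morphism (c : central_idempotent R) :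
  zmod_morphism (corner_proj c).
Proof. by move=> x y; apply: val_inj; rewrite raddfB /= mulrBr. Qed.

Lemma corner_proj_monoid_morphism (c : central_idempotent R) :
  monoid_morphism (corner_proj c).
Proof.
split=> [|x y]; apply: val_inj; rewrite /= ?mulr1 //.
by rewrite [RHS]mulrA -[_ * x * cidem_val c]mulrA -(cidem_comm c x)
  !mulrA (cidem_idem c).
Qed.

Fact peirce_zmod_morphism : zmod_morphism peirce.
Proof. by move=> x y; rewrite /peirce !corner_proj_zmod_morphism. Qed.

Fact peirce_monoid_morphism : monoid_morphism peirce.
Proof.
split=> [|x y]; rewrite /peirce.
  by rewrite !(corner_proj_monoid_morphism _).1.
by rewrite !(corner_proj_monoid_morphism _).2.
Qed.

HB.instance Definition _ := GRing.isZmodMorphism.Build R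
  (corner e * corner (cidem_compl e))%type peirce peirce_zmod_morphism.
HB.instance Definition _ := GRing.isMonoidMorphism.Build R
  (corner e * corner (cidem_compl e))%type peirce peirce_monoid_morphism.

Lemma peirce_isomorphic :
  ring_isomorphic R (corner e * corner (cidem_compl e))%type.
Proof.
exists (peirce : {rmorphism _ -> _}).
(* The inverse adds the two components; it works because e annihilates the second corner. *)
exists (fun y => val y.1 + val y.2) => [x|[x y]] /=.
  by rewrite -mulrDl addrC subrK mul1r.
have x1 := corner_mul1 x; have := corner_mul1 y.
rewrite /= mulrBl mul1r => y1.
have y0 : cidem_val e * val y = 0.
  by apply/eqP; rewrite -oppr_eq0 -(inj_eq (addrI (val y))) addr0 y1.
congr pair; apply: val_inj => /=; first by rewrite mulrDr x1 y0 addr0.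
by rewrite mulrBl mul1r mulrDr x1 y0 addr0 addrC addKr.
Qed.

End Peirce.

(** * Recognition of Z_3 *)

Lemma natr_modn3 (R : pzRingType) (n : nat) :
  3%:R = 0 :> R -> (n %% 3)%N%:R = n%:R :> R.
Proof.
by move=> R3; rewrite [in RHS](divn_eq n 3) natrD natrM R3 mulr0 add0r.
Qed.

Lemma Z3_cases (a : 'Z_3) : [\/ a = 0, a = 1 | a = -1].
Proof.
case: a => [[|[|[|//]]] i];
  [apply: Or31 | apply: Or32 | apply: Or33]; exact: val_inj.
Qed.

Lemma ring_isomorphic_Z3 (R : pzRingType) :
  1 <> 0 :> R -> 3%:R = 0 :> R ->
  (forall x : R, [\/ x = 0, x = 1 | x = -1]) -> ring_isomorphic R 'Z_3.
Proof.
move=> R10 R3 Rcases.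
pose g (a : 'Z_3) : R := (a : nat)%:R.
have g0 : g 0 = 0 by [].
have g1 : g 1 = 1 by [].
have gD : {morph g : a b / a + b}.
  by move=> a b; rewrite /g -natrD -[RHS]natr_modn3.
have gN : {morph g : a / - a}.
  by move=> a; apply/eqP; rewrite -addr_eq0 -gD addNr g0.
have gB : zmod_morphism g by move=> a b; rewrite gD gN.
have gM : monoid_morphism g.
  by split=> // a b; rewrite /g -natrM -[RHS]natr_modn3.
pose gBb := GRing.isZmodMorphism.Build _ _ g gB.
pose gMb := GRing.isMonoidMorphism.Build _ _ g gM.
pose G : {rmorphism 'Z_3 -> R} := HB.pack g gBb gMb.
pose f (x : R) : 'Z_3 := if x == 0 then 0 else if x == 1 then 1 else -1.
have f0 : f 0 = 0 by rewrite /f eqxx.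
have f1 : f 1 = 1 by rewrite /f eqxx; case: eqP.
have fN1 : f (-1) = -1.
  (* If -1 = 1, then 0 = 3 = 1 - 1 + 1 = 1. *)
  rewrite /f oppr_eq0; case: eqP => // _; case: eqP => // N11.
  by case: R10; rewrite -R3 !mulrSr mulr0n add0r -[X in 1 + X]N11 subrr add0r.
apply: (@can2_ring_isomorphic _ _ G f) => [x|a] /=.
  by case: (Rcases x) => ->; rewrite ?f0 ?f1 ?fN1 ?gN.
by case: (Z3_cases a) => ->; rewrite ?gN ?g0 ?g1.
Qed.

(** * The four kinds of rings satisfy the condition *)

Lemma Boolean_ring_comm (B : pzRingType) :
  Boolean_ring B -> forall x y : B, x * y = y * x.
Proof.
move=> bB x y; have Bsq (z : B) : z * z = z := bB z.
have add_self (z : B) : z + z = 0.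
  have := Bsq (z + z); rewrite mulrDl mulrDr !Bsq => /(canRL (addrK _)).
  by rewrite subrr.
have := Bsq (x + y); rewrite mulrDl !mulrDr !Bsq -addrA => /addrI.
rewrite addrA -[RHS]add0r => /addIr /eqP; rewrite addr_eq0 => /eqP ->.
by apply/esym/eqP; rewrite -addr_eq0 add_self.
Qed.

Definition zd_very_idempotent_or_nilpotent (R : pzRingType) : Prop :=
  forall a : R, zero_divisor a -> very_idempotent a \/ nilpotent a.

Section InjectiveMorphism.
Variables (R S : pzRingType) (f : {rmorphism R -> S}).
Hypothesis f_inj : injective f.

Lemma abelian_ring_inj : abelian_ring S -> abelian_ring R.
Proof.
move=> abS e ee x; apply: f_inj; rewrite !rmorphM; apply: abS.
by rewrite /Defs.idempotent -rmorphM ee.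
Qed.

(** Injectivity keeps the two annihilators nonzero, so zero-divisors map to zero-divisors, while
    idempotency and nilpotency are reflected. *)
Lemma zd_very_idempotent_or_nilpotent_inj :
  zd_very_idempotent_or_nilpotent S -> zd_very_idempotent_or_nilpotent R.
Proof.
move=> zdS a [b [c [b0 c0 ab ca]]].
have f0 (x : R) : x <> 0 -> f x <> 0 by rewrite -(rmorph0 f) => x0 /f_inj.
have /zdS [[]|[n [n0 fan]]] : zero_divisor (f a).
- exists (f b), (f c).
  by split; [exact: f0 | exact: f0 | | ]; rewrite -rmorphM ?ab ?ca rmorph0.
- by rewrite /Defs.idempotent -rmorphM => /f_inj; left; left.
- by rewrite /Defs.idempotent -rmorphN -rmorphM => /f_inj; left; right.
- by right; exists n; split=> //; apply: f_inj; rewrite rmorphXn rmorph0.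
Qed.

End InjectiveMorphism.

(** A D-ring has only the idempotents 0 and 1: any other e is annihilated by 1 - e, hence nilpotent,
    yet all its positive powers equal e. *)
Lemma D_ring_abelian (R : pzRingType) : D_ring R -> abelian_ring R.
Proof.
move=> dR e ee x.
have expe n : e ^+ n.+1 = e by elim: n => // n IH; rewrite exprS IH.
have [->|e0] := eqVneq e 0; first by rewrite /GRing.comm mul0r mulr0.
have [->|e1] := eqVneq e 1; first by rewrite /GRing.comm mul1r mulr1.
have f0 : 1 - e <> 0 by move/eqP; rewrite subr_eq0 eq_sym (negPf e1).
have /dR [[|n] [//]] : zero_divisor e.
  by exists (1 - e), (1 - e); split=> //; rewrite ?mulrBr ?mulrBl ?mulr1 ?mul1r
    ee subrr.
by rewrite expe => _ e_0; rewrite e_0 eqxx in e0.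
Qed.

Lemma Boolean_ring_abelian (B : pzRingType) : Boolean_ring B -> abelian_ring B.
Proof. by move=> bB e _ x; apply: Boolean_ring_comm. Qed.

(** Since Z_3 has no nonzero zero-divisors, one coordinate vanishes, and the other is 0, 1 or -1. *)
Lemma Z3_Z3_zd :
  zd_very_idempotent_or_nilpotent ('Z_3 * 'Z_3)%type.
Proof.
move=> [a b] [[c1 c2] [d [c0 _ abc _]]].
have ac : a * c1 = 0 := congr1 fst abc.
have bc : b * c2 = 0 := congr1 snd abc.
have unitZ (x y : 'Z_3) : x <> 0 -> x * y = 0 -> y = 0.
  by case: (Z3_cases x) => -> // _; rewrite ?mulN1r ?mul1r // => /eqP;
    rewrite oppr_eq0 => /eqP.
have [a0|a0] := eqVneq a 0; last first.
  have [b0|b0] := eqVneq b 0; last first.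
    by case: c0; rewrite (unitZ _ _ (elimN eqP a0) ac)
      (unitZ _ _ (elimN eqP b0) bc).
  by left; rewrite b0; case: (Z3_cases a) => ->; [left|left|right]; congr pair;
    apply: val_inj.
by left; rewrite a0; case: (Z3_cases b) => ->; [left|left|right]; congr pair;
  apply: val_inj.
Qed.

(** The Z_3 coordinate dictates the sign; either sign suits B, where -b is idempotent too. *)
Lemma Z3_Boolean_very_idempotent (B : pzRingType) :
  Boolean_ring B -> forall x : 'Z_3 * B, very_idempotent x.
Proof.
move=> bB [a b]; have bb (z : B) : z * z = z := bB z.
case: (Z3_cases a) => ->; [left|left|right]; congr pair;
  solve [exact: val_inj | exact: bb].
Qed.

(** * Rings with a nontrivial idempotent *)

Section NontrivialIdempotent.
Variable R : pzRingType.
Hypothesis abR : abelian_ring R.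
Hypothesis zdR : zd_very_idempotent_or_nilpotent R.

(* If [y <> 0], then [y + (1 - e)] is a zero-divisor, but neither a very
   idempotent nor nilpotent. *)
Lemma corner_square_eq0 (e y : R) :
  e * e = e -> e <> 1 -> e * y = y -> y * y = 0 -> y = 0.
Proof.
move=> ee e1 ey yy; pose f := 1 - e.
have f0 : f <> 0 by move/eqP; rewrite subr_eq0 eq_sym => /eqP.
have ef : e * f = 0 by rewrite mulrBr mulr1 ee subrr.
have ff : f * f = f by rewrite {1}/f mulrBl mul1r ef subr0.
have fy : f * y = 0 by rewrite mulrBl mul1r ey subrr.
have yf : y * f = 0 by rewrite -(abR ff).
clearbody f.
have sq : (y + f) * (y + f) = f.
  by rewrite mulrDl !mulrDr yy yf fy ff !add0r.
apply/eqP; apply: contraT => /eqP y0.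
have /zdR [[]|[n [_ yfn]]] : zero_divisor (y + f).
- by exists y, y; split=> //; rewrite ?mulrDl ?mulrDr yy ?fy ?yf addr0.
- by rewrite /Defs.idempotent sq -{1}[f]add0r => /addIr /esym.
- rewrite /Defs.idempotent mulrNN sq => /(congr1 ( *%R e)).
  by rewrite mulrN mulrDr ef ey addr0 => /esym /eqP; rewrite oppr_eq0 => /eqP.
(* Nilpotency of y + f would force f = 0, since f absorbs every power of y + f. *)
- have fpow m : f * (y + f) ^+ m = f.
    elim: m => [|m IH]; first by rewrite mulr1.
    by rewrite exprS mulrA mulrDr fy ff add0r IH.
  by case: f0; rewrite -(fpow n) yfn mulr0.
Qed.

Variable e : R.
Hypotheses (ee : e * e = e) (e0 : e <> 0) (e1 : e <> 1).

Lemma compl_idem : (1 - e) * (1 - e) = 1 - e.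
Proof. by rewrite mulrBr mulr1 mulrBl mul1r ee subrr subr0. Qed.

Lemma compl_neq0 : 1 - e <> 0.
Proof. by move/eqP; rewrite subr_eq0 eq_sym => /eqP. Qed.

Lemma compl_neq1 : 1 - e <> 1.
Proof. by rewrite -[X in _ <> X]subr0 => /addrI /oppr_inj. Qed.

(** Both ea and (1 - e)a square to zero in proper corners, so [corner_square_eq0] kills each of
    them. *)
Lemma square_eq0 (a : R) : a * a = 0 -> a = 0.
Proof.
move=> aa.
have part (c : R) : c * c = c -> c <> 1 -> c * a = 0.
  move=> cc c1; apply: (corner_square_eq0 cc c1); first by rewrite mulrA cc.
  by rewrite mulrA -[c * a * c]mulrA -(abR cc) mulrA cc -mulrA aa mulr0.
rewrite -[a]mul1r -(subrK e 1) mulrDl (part _ ee e1).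
by rewrite (part _ compl_idem compl_neq1) addr0.
Qed.

Lemma nilpotent_eq0 (a : R) : nilpotent a -> a = 0.
Proof.
case=> -[|n] [] // _; elim: n => // n IH an.
by apply/IH/square_eq0; rewrite {1}exprSr -mulrA -exprS an mulr0.
Qed.

Lemma zero_divisor_square (a : R) :
  zero_divisor a -> a * a = a \/ a * a = - a.
Proof.
move=> /zdR [[]|/nilpotent_eq0 ->]; last by left; rewrite mulr0.
- by left.
- by rewrite /Defs.idempotent mulrNN; right.
Qed.

(** For c = e and c = 1 - e, the element cx is annihilated by 1 - c. Its square is therefore cx or
    -cx, and in both cases its cube is cx. *)
Lemma cube_id (x : R) : x * x * x = x.
Proof.
have part (c : R) : c * c = c -> 1 - c <> 0 -> c * (x * x * x) = c * x.
  move=> cc c1.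
  have c_c (z : R) : c * x * (c * z) = c * (x * z).
    by rewrite mulrA -[c * x * c]mulrA -(abR cc) !mulrA cc.
  have -> : c * (x * x * x) = c * x * (c * x) * (c * x).
    by rewrite -[RHS]mulrA !c_c [x * (x * x)]mulrA.
  have /zero_divisor_square [cx|cx] : zero_divisor (c * x).
  - have fc : (1 - c) * c = 0 by rewrite mulrBl mul1r cc subrr.
    exists (1 - c), (1 - c); split=> //; last by rewrite mulrA fc mul0r.
    by rewrite -mulrA mulrBr mulr1 -(abR cc) mulrBr mulrA cc subrr.
  - by rewrite !cx.
  - by rewrite cx mulNr cx opprK.
rewrite -[LHS]mul1r -[RHS]mul1r -(subrK e 1) mulrDl [RHS]mulrDl.
rewrite (part _ ee compl_neq0) (part _ compl_idem) //.
by rewrite opprB addrC subrK.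
Qed.

End NontrivialIdempotent.

(** * Rings satisfying x^3 = x *)

Lemma mulr3n0_add (R : pzRingType) (x : R) : x *+ 3 = 0 -> x + x = - x.
Proof. by move=> x3; apply/eqP; rewrite -addr_eq0 -mulr2n -mulrSr x3. Qed.

Section CubeRing.
Variable R : pzRingType.
Hypothesis cube : forall x : R, x * x * x = x.

(** The cube law at 2 reads 8 = 2. *)
Lemma natr6_eq0 : 6%:R = 0 :> R.
Proof.
have := cube 2%:R; rewrite -!natrM -[(2 * 2 * 2)%N]/(6 + 2)%N natrD.
by rewrite -[RHS]add0r => /addIr.
Qed.

(** Expanding the cube law at x + 1 gives 3x^2 + 3x = 0, and -3x = 3x because 6 = 0. *)
Lemma mulr3n_square (x : R) : x * x *+ 3 = x *+ 3.
Proof.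
have x6 : x *+ 3 = - (x *+ 3).
  apply/eqP; rewrite -addr_eq0 -mulrnDr -[(3 + 3)%N]/6%N -mulr_natl.
  by rewrite natr6_eq0 mul0r.
have : (x + 1) * (x + 1) * (x + 1) = x * x *+ 3 + x *+ 3 + (x + 1).
  rewrite !mulrDl !mulrDr !mulrDl !mulr1 !mul1r cube.
  rewrite !mulrSr !mulr0n !add0r.
  by rewrite [LHS](AC ((2*2)*(2*2)) ((2*3*5)*(1*4*6)*(7*8))).
rewrite cube -[LHS]add0r => /addIr /esym /eqP; rewrite addr_eq0 => /eqP ->.
by rewrite -x6.
Qed.

(** As 1 - 4 = -3, the hypothesis says y = -3y, and [mulr3n_square] gives y^2 = -3y^2 = -3y = y. *)
Lemma corner3_square (y : R) : (1 - 4%:R) * y = y -> y * y = y.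
Proof.
rewrite mulrBl mul1r mulr_natl mulrSr opprD addrA addrAC subrr add0r => y3.
by rewrite -[LHS]opprK -mulNr -{1}y3 opprK mulrnAl mulr3n_square -[RHS]y3.
Qed.

(** With t = u + u^2, the cube law gives t^2 = 2t, which is -t because 3t = 0. *)
Lemma cube_idempotent (u : R) :
  u *+ 3 = 0 -> - (u + u * u) * - (u + u * u) = - (u + u * u).
Proof.
move=> u3; rewrite mulrNN; set t := u + u * u.
have t3 : t *+ 3 = 0 by rewrite mulrnDl -mulrnAl u3 mul0r addr0.
rewrite -(mulr3n0_add t3) /t mulrDl !mulrDr !mulrA !cube.
by rewrite [u * u + u]addrC.
Qed.

Lemma primitive_corner3 (p : R) : p *+ 3 = 0 ->
  (forall r, r * r = r -> p * r = r -> r = 0 \/ r = p) ->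
  forall y, p * y = y -> [\/ y = 0, y = p | y = - p].
Proof.
move=> p3 prim y py.
have y3 : y *+ 3 = 0 by rewrite -py -mulrnAl p3 mul0r.
have Ny3 : (- y) *+ 3 = 0 by rewrite mulNrn y3 oppr0.
have pa : p * - (y + y * y) = - (y + y * y).
  by rewrite mulrN mulrDr mulrA py.
have pb : p * - (- y + - y * - y) = - (- y + - y * - y).
  by rewrite mulrN mulrDr mulrA mulrN py.
(* The difference of the idempotents obtained from y and from -y is -2y, that is y. *)
have yab : y = - (y + y * y) - - (- y + - y * - y).
  rewrite opprK mulrNN opprD addrACA addNr addr0 -opprD.
  by rewrite (mulr3n0_add y3) opprK.
have [a|a] := prim _ (cube_idempotent y3) pa;
have [b|b] := prim _ (cube_idempotent Ny3) pb; rewrite yab a b.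
- by apply: Or31; rewrite subr0.
- by apply: Or33; rewrite sub0r.
- by apply: Or32; rewrite subr0.
- by apply: Or31; rewrite subrr.
Qed.

End CubeRing.

(** * Corners of characteristic 3 *)

Lemma ring_isomorphic_corner_Z3 (R : pzRingType) (p : central_idempotent R) :
  cidem_val p <> 0 -> cidem_val p *+ 3 = 0 ->
  (forall y, cidem_val p * y = y ->
     [\/ y = 0, y = cidem_val p | y = - cidem_val p]) ->
  ring_isomorphic (corner p) 'Z_3.
Proof.
move=> p0 p3 cases; apply: ring_isomorphic_Z3.
- by move=> /(congr1 val).
- by apply: val_inj; rewrite raddfMn /= p3.
- move=> x; have [x0|x1|xN] := cases _ (corner_mul1 x).
  + by apply: Or31; apply: val_inj.
  + by apply: Or32; apply: val_inj.
  + by apply: Or33; apply: val_inj; rewrite raddfN.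
Qed.

(* Otherwise [p - q] is a zero-divisor whose square [p + q] is not [±(p - q)]. *)
Lemma orthogonal3_sum (R : pzRingType) (p q : R) :
  (forall a : R, zero_divisor a -> a * a = a \/ a * a = - a) ->
  p * p = p -> q * q = q -> p * q = 0 -> q * p = 0 -> p <> 0 -> q <> 0 ->
  p *+ 3 = 0 -> q *+ 3 = 0 -> p + q = 1.
Proof.
move=> zd2 pp qq pq qp p0 q0 p3 q3; apply: NNPP => pq1.
have c0 : 1 - (p + q) <> 0 by move/eqP; rewrite subr_eq0 eq_sym => /eqP.
have zero2 (x : R) : x *+ 3 = 0 -> x = - x -> x = 0.
  by move=> /mulr3n0_add x3 xN; move: x3; rewrite -xN => /(canRL (addrK x));
    rewrite subrr.
have sq : (p - q) * (p - q) = p + q.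
  by rewrite mulrBl !mulrBr pp qq pq qp subr0 sub0r opprK.
have /zd2 : zero_divisor (p - q).
  exists (1 - (p + q)), (1 - (p + q)); split=> //.
    by rewrite mulrBr mulr1 mulrBl !mulrDr pp qq pq qp addr0 add0r subrr.
  by rewrite mulrBl mul1r mulrDl !mulrBr pp qq pq qp subr0 sub0r subrr.
rewrite sq => -[/addrI /(zero2 _ q3) //|].
by rewrite opprB [RHS]addrC => /addIr /(zero2 _ p3).
Qed.

Theorem theorem3p7 (R : pzRingType) :
  (abelian_ring R /\
   (forall a : R, zero_divisor a -> very_idempotent a \/ nilpotent a))
  <->
  [\/ exists S : pzRingType, D_ring S /\ ring_isomorphic R S,
      exists B : pzRingType, Boolean_ring B /\ ring_isomorphic R B,
      ring_isomorphic R ('Z_3 * 'Z_3)%type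
    | exists B : pzRingType,
        Boolean_ring B /\ ring_isomorphic R ('Z_3 * B)%type].
Proof.
split=> [[abR zdR]|]; last first.
  (* Both conditions are pulled back along the isomorphism, so only the four model rings need
     checking. *)
  have transfer (S : pzRingType) : ring_isomorphic R S -> abelian_ring S ->
      zd_very_idempotent_or_nilpotent S ->
      abelian_ring R /\ zd_very_idempotent_or_nilpotent R.
    move=> [f /bij_inj f_inj] abS zdS; split.
      exact: abelian_ring_inj f_inj abS.
    exact: zd_very_idempotent_or_nilpotent_inj f_inj zdS.
  case=> [[S [dS]]|[B [bB]]||[B [bB]]] /transfer; apply.
  - exact: D_ring_abelian.
  - by move=> a /dS; right.
  - exact: Boolean_ring_abelian.
  - by move=> a _; left; left; apply: bB.
  - by move=> x _ y; apply: mulrC.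
  - exact: Z3_Z3_zd.
  - move=> [x1 x2] _ [y1 y2]; congr pair; first exact: mulrC.
    exact: Boolean_ring_comm.
  - by move=> a _; left; apply: Z3_Boolean_very_idempotent.
have [[e [ee e0 e1]]|ntriv] :=
    classic (exists e : R, [/\ e * e = e, e <> 0 & e <> 1]); last first.
  have triv (e : R) : e * e = e -> e = 0 \/ e = 1.
    have [->|/eqP e0] := eqVneq e 0; first by left.
    have [->|/eqP e1] := eqVneq e 1; first by right.
    by move=> ee; case: ntriv; exists e.
  apply: Or41; exists R; split; last exact: ring_isomorphic_refl.
  move=> a zda; have [[/triv|/triv]|//] := zdR a zda.
  (* Neither 1 nor -1 annihilates a nonzero element, so the zero-divisor a is 0. *)
  - case=> a01; first by exists 1%N; rewrite a01 expr1.
    case: zda => b [c [b0 _]]; rewrite a01 mul1r => /b0 //.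
  - case=> a01; rewrite -(opprK a) a01.
      by exists 1%N; rewrite expr1 oppr0.
    case: zda => b [c [b0 _]]; rewrite -(opprK a) a01 mulN1r => /eqP.
    by rewrite oppr_eq0 => /eqP.
have cube := cube_id abR zdR ee e0 e1.
have zd2 := zero_divisor_square abR zdR ee e0 e1.
have R6 := natr6_eq0 cube.
(* Modulo 6, the class of 4 is the idempotent that is 0 modulo 2 and 1 modulo 3. *)
pose h : R := 4%:R.
have hh : h * h = h.
  by rewrite /h -natrM -[(4 * 4)%N]/(6 + 6 + 4)%N !natrD R6 !add0r.
have h3 : h *+ 3 = 0.
  by rewrite /h -mulrnA -[(4 * 3)%N]/(6 + 6)%N natrD R6 addr0.
have [h0|/eqP h0] := eqVneq h 0.
  apply: Or42; exists R; split; last exact: ring_isomorphic_refl.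
  by move=> x; apply: (corner3_square cube); rewrite -/h h0 subr0 mul1r.
(* Either h splits or it is primitive; the primitive case, treated first, yields Z_3 times a Boolean
   ring. *)
have [[r [rr hr r0 rh]]|nprim] :=
    classic (exists r, [/\ r * r = r, h * r = r, r <> 0 & r <> h]); last first.
  have prim r : r * r = r -> h * r = r -> r = 0 \/ r = h.
    have [->|/eqP r0] := eqVneq r 0; first by left.
    have [->|/eqP rh] := eqVneq r h; first by right.
    by move=> rr hr; case: nprim; exists r.
  pose H := CentralIdempotent hh (abR _ hh).
  apply: Or44; exists (corner (cidem_compl H)); split.
    move=> y; apply: val_inj; apply: (corner3_square cube).
    exact: (corner_mul1 y).
  apply: ring_isomorphic_trans (peirce_isomorphic H) _.
  apply: ring_isomorphic_prod; last exact: ring_isomorphic_refl.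
  apply: ring_isomorphic_corner_Z3 => //.
  exact: primitive_corner3.
pose q := h - r.
have rhr : r * h = r by rewrite -(abR _ hh).
have q0 : q <> 0 by move/eqP; rewrite subr_eq0 eq_sym => /eqP.
have rq : r * q = 0 by rewrite mulrBr rhr rr subrr.
have qr : q * r = 0 by rewrite mulrBl hr rr subrr.
have qq : q * q = q by rewrite {1}/q mulrBl rq subr0 mulrBr hh hr.
have r3 : r *+ 3 = 0 by rewrite -hr -mulrnAl h3 mul0r.
have q3 : q *+ 3 = 0 by rewrite mulrnBl h3 r3 subrr.
have rq1 : r + q = 1 by apply: orthogonal3_sum.
(* A nonzero idempotent s of pR is orthogonal to c, so [orthogonal3_sum] gives s + c = 1 = p + c,
   whence s = p. This is applied to r and q in both orders. *)
have prim (p c : R) : p * p = p -> c * c = c -> c * p = 0 -> c <> 0 ->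
    c *+ 3 = 0 -> p *+ 3 = 0 -> p + c = 1 ->
    forall s, s * s = s -> p * s = s -> s = 0 \/ s = p.
  move=> pp cc cp c0 c3 p3 pc1 s ss ps.
  have [->|/eqP s0] := eqVneq s 0; [by left | right].
  have cs : c * s = 0 by rewrite -ps mulrA cp mul0r.
  have sc : s * c = 0 by rewrite (abR _ ss).
  apply: (addIr c); rewrite pc1; apply: orthogonal3_sum => //.
  by rewrite -ps -mulrnAl p3 mul0r.
pose P := CentralIdempotent rr (abR _ rr).
have Q_val : cidem_val (cidem_compl P) = q by rewrite /= -rq1 addrC addKr.
apply: Or43; apply: ring_isomorphic_trans (peirce_isomorphic P) _.
apply: ring_isomorphic_prod; apply: ring_isomorphic_corner_Z3 => //;
  rewrite ?Q_val //.
- by apply: primitive_corner3 => //; apply: (prim _ q).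
- by apply: primitive_corner3 => //; apply: (prim _ r) => //; rewrite addrC.
Qed.
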